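(* Let $G$ be a $\{P_5,\overline{P_5},C_5\}$-free graph. Then at least one of the following holds: (i) $G$ is a split graph; (ii) $G$ contains a proper homogeneous set; (iii) at least one of $G$ and $\overline{G}$ admits a split graph divide.
   Context: All graphs are finite and simple. $V_G$ is the vertex-set of $G$ and $\overline{G}$ is the complement of $G$. $P_5$ is the path on five vertices and $C_5$ the cycle on five vertices. $G$ is $\mathcal{H}$-free if no induced subgraph of $G$ is isomorphic to a member of $\mathcal{H}$. A split graph is a graph whose vertex-set can be partitioned into a (possibly empty) clique and a (possibly empty) stable set. A vertex $v\notin X$ is complete (anti-complete) to $X$ if it is adjacent (non-adjacent) to every vertex of $X$, and mixed on $X$ if it is neither; disjoint sets $A,B$ are complete (anti-complete) to each other if every vertex of $A$ is complete (anti-complete) to $B$. A set $X\subseteq V_G$ is a homogeneous set in $G$ if no vertex of $V_G\smallsetminus X$ is mixed on $X$; it is proper if $2\le|X|\le|V_G|-1$. Given pairwise disjoint (possibly empty) sets $A,B,C,L,T\subseteq V_G$, the tuple $(A,B,C,L,T)$ is a split graph divide of $G$ if: $V_G=A\cup B\cup C\cup L\cup T$; $|A|\ge 2$; $|C|\ge 2$; $L$ is a non-empty clique; $T$ is a (possibly empty) stable set; every vertex of $L$ is mixed on $A$; $A$ is complete to $B$ and anti-complete to $C\cup T$; $L$ is complete to $B\cup C$; and $T$ is anti-complete to $C$. $G$ admits a split graph divide if such a tuple exists. *)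

(* Defs.v *)
From Stdlib Require List.
From mathcomp Require Import all_boot.

Set Implicit Arguments.
Unset Strict Implicit.
Unset Printing Implicit Defensive.

(* Finite simple graphs; the vertex type may be empty. *)
Record sgraph := SGraph {
  vertex :> finType;
  adj : rel vertex;
  adj_sym : symmetric adj;
  adj_irrefl : irreflexive adj }.

Definition compl_adj (G : sgraph) : rel G :=
  fun x y => (x != y) && ~~ adj x y.

Lemma compl_adj_sym (G : sgraph) : symmetric (@compl_adj G).
Proof. by move=> x y; rewrite /compl_adj eq_sym adj_sym. Qed.

Lemma compl_adj_irrefl (G : sgraph) : irreflexive (@compl_adj G).
Proof. by move=> x; rewrite /compl_adj eqxx. Qed.

Definition compl (G : sgraph) : sgraph :=
  SGraph (@compl_adj_sym G) (@compl_adj_irrefl G).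

Definition induced_adj (G : sgraph) (S : {set G}) : rel {x : G | x \in S} :=
  fun x y => adj (val x) (val y).

Lemma induced_adj_sym (G : sgraph) (S : {set G}) : symmetric (@induced_adj G S).
Proof. by move=> x y; apply: adj_sym. Qed.

Lemma induced_adj_irrefl (G : sgraph) (S : {set G}) :
  irreflexive (@induced_adj G S).
Proof. by move=> x; apply: adj_irrefl. Qed.

Definition induced (G : sgraph) (S : {set G}) : sgraph :=
  SGraph (@induced_adj_sym G S) (@induced_adj_irrefl G S).

Definition isomorphic (G H : sgraph) : Prop :=
  exists2 f : G -> H, bijective f & forall x y, adj (f x) (f y) = adj x y.

(* sgraph has no decidable equality, hence List.In rather than \in. *)
Definition free (Hs : seq sgraph) (G : sgraph) : Prop :=
  forall H, List.In H Hs -> forall S : {set G}, ~ isomorphic (induced S) H.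

Definition P5_adj : rel 'I_5 := fun i j => (i.+1 == j) || (j.+1 == i).

Lemma P5_adj_sym : symmetric P5_adj.
Proof. by move=> i j; rewrite /P5_adj orbC. Qed.

Lemma P5_adj_irrefl : irreflexive P5_adj.
Proof. by case=> [[|[|[|[|[|]]]]]]. Qed.

Definition P5 : sgraph := SGraph P5_adj_sym P5_adj_irrefl.

Definition C5_adj : rel 'I_5 := fun i j => (i.+1 %% 5 == j) || (j.+1 %% 5 == i).

Lemma C5_adj_sym : symmetric C5_adj.
Proof. by move=> i j; rewrite /C5_adj orbC. Qed.

Lemma C5_adj_irrefl : irreflexive C5_adj.
Proof. by case=> [[|[|[|[|[|]]]]]]. Qed.

Definition C5 : sgraph := SGraph C5_adj_sym C5_adj_irrefl.

Definition clique (G : sgraph) (K : {set G}) : bool :=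
  [forall x in K, forall y in K, (x != y) ==> adj x y].

Definition stable (G : sgraph) (S : {set G}) : bool :=
  [forall x in S, forall y in S, ~~ adj x y].

Definition split_graph (G : sgraph) : Prop :=
  exists K S : {set G},
    [/\ K :|: S = [set: G], [disjoint K & S], clique K & stable S].

(* The three notions below are only meant for v \notin X. *)
Definition vcomplete (G : sgraph) (v : G) (X : {set G}) : bool :=
  [forall x in X, adj v x].

Definition vanticomplete (G : sgraph) (v : G) (X : {set G}) : bool :=
  [forall x in X, ~~ adj v x].

Definition mixed (G : sgraph) (v : G) (X : {set G}) : bool :=
  ~~ vcomplete v X && ~~ vanticomplete v X.

(* These two are only meant for disjoint A and B. *)
Definition complete (G : sgraph) (A B : {set G}) : bool :=
  [forall a in A, vcomplete a B].

Definition anticomplete (G : sgraph) (A B : {set G}) : bool :=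
  [forall a in A, vanticomplete a B].

Definition homogeneous (G : sgraph) (X : {set G}) : bool :=
  [forall v, (v \notin X) ==> ~~ mixed v X].

(* #|X| < #|G| renders |X| <= |V_G| - 1, avoiding truncated subtraction. *)
Definition proper_homogeneous (G : sgraph) (X : {set G}) : bool :=
  [&& homogeneous X, 2 <= #|X| & #|X| < #|G|].

Record split_graph_divide (G : sgraph) (A B C L T : {set G}) : Prop := {
  sgd_disjoint :
    pairwise (fun X Y : {set G} => [disjoint X & Y]) [:: A; B; C; L; T];
  sgd_cover : [set: G] = A :|: B :|: C :|: L :|: T;
  sgd_cardA : 2 <= #|A|;
  sgd_cardC : 2 <= #|C|;
  sgd_L_neq0 : L != set0;
  sgd_L_clique : clique L;
  sgd_T_stable : stable T;
  sgd_L_mixed : forall v, v \in L -> mixed v A;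
  sgd_A_B : complete A B;
  sgd_A_CT : anticomplete A (C :|: T);
  sgd_L_BC : complete L (B :|: C);
  sgd_T_C : anticomplete T C }.

Definition admits_split_graph_divide (G : sgraph) : Prop :=
  exists A B C L T : {set G}, split_graph_divide A B C L T.

(* Main.v *)
(** A prime graph that is not split contains an induced 2K2, up to complement.
    Take a maximal set [W] inducing a disconnected graph without isolated
    vertices.  By maximality and [P5]-freeness, the vertices outside [W] that
    have a neighbour in [W] (call their set [S]) have neighbours in every
    component of [W] and are mixed on at most one; the remaining vertices form
    a stable set [Z].  If the set [L] of the vertices mixed on a component [A]
    is a clique, then [(A, S \ L, W \ A, L, Z)] is a split graph divide.

    If no such [L] is a clique, the vertices of [S] having a non-neighbour in
    [S] induce, in the complement, a disconnected graph without isolated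
    vertices.  Extend them to a maximal such set [W'] of the complement.  Some
    component of [W'] lies inside [S]; since non-adjacent vertices of [S] have
    the same neighbours in [W], only vertices of [Z] can be mixed on it, and
    [Z] is a clique of the complement, which therefore admits a divide. *)

Require Import Defs.
From mathcomp Require Import all_boot.

Set Implicit Arguments.
Unset Strict Implicit.
Unset Printing Implicit Defensive.

(** * Forbidden induced subgraphs as adjacency patterns *)

Definition P5_free (G : sgraph) := forall a b c d f : G,
  adj a b -> adj b c -> adj c d -> adj d f ->
  ~~ adj a c -> ~~ adj a d -> ~~ adj a f ->
  ~~ adj b d -> ~~ adj b f -> ~~ adj c f -> False.

(* The complement of [P5] is a 4-cycle [a b c d] with a roof [f] over [a b]. *)
Definition house_free (G : sgraph) := forall a b c d f : G,
  adj a b -> adj b c -> adj c d -> adj d a -> adj f a -> adj f b ->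
  ~~ adj a c -> ~~ adj b d -> ~~ adj f c -> ~~ adj f d -> False.

Definition C5_free (G : sgraph) := forall a b c d f : G,
  adj a b -> adj b c -> adj c d -> adj d f -> adj f a ->
  ~~ adj a c -> ~~ adj a d -> ~~ adj b d -> ~~ adj b f -> ~~ adj c f -> False.

Definition P5_house_C5_free (G : sgraph) :=
  [/\ P5_free G, house_free G & C5_free G].

Definition prime_graph (G : sgraph) := forall X : {set G}, ~~ proper_homogeneous X.

Lemma free_embedding (Hs : seq sgraph) (G H : sgraph) (f : H -> G) :
  free Hs G -> List.In H Hs -> injective f ->
  (forall x y, adj (f x) (f y) = adj x y) -> False.
Proof.
move=> Gfree HHs finj fadj; pose S := [set f x | x : H].
have fS x : f x \in S by apply: imset_f.
pose g (x : H) : induced S := exist _ (f x) (fS x).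
have ginj : injective g by move=> x y /(congr1 val) /finj.
have gcard : #|induced S| <= #|H|.
  by rewrite card_sig -[#|H|](card_imset _ finj) subset_leq_card //; apply/subsetP.
have [h gK hK] := inj_card_bij ginj gcard.
apply: (Gfree H HHs S); exists h; first by exists g.
by move=> x y; rewrite -{2}(hK x) -{2}(hK y) /= /induced_adj /= fadj.
Qed.

(** Vertices with the same image have the same neighbours, so injectivity is automatic when no two
    vertices of [H] are twins. This is why the five-vertex patterns above contain no
    inequalities. *)
Lemma twinfree_free (Hs : seq sgraph) (G H : sgraph) (f : H -> G) :
  free Hs G -> List.In H Hs -> (forall x y : H, adj x =1 adj y -> x = y) ->
  (forall x y, adj (f x) (f y) = adj x y) -> False.
Proof.
move=> Gfree HHs twins fadj; apply: (free_embedding Gfree HHs _ fadj) => x y fxy.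
by apply: twins => z; rewrite -!fadj fxy.
Qed.

Ltac twinfree :=
  move=> [[|[|[|[|[|?]]]]] ?] [[|[|[|[|[|?]]]]] ?] // h;
  first [ exact: val_inj | by have := h (@Ordinal 5 0 isT)
        | by have := h (@Ordinal 5 1 isT) | by have := h (@Ordinal 5 2 isT)
        | by have := h (@Ordinal 5 3 isT) | by have := h (@Ordinal 5 4 isT) ].

Lemma free_P5_house_C5_free (G : sgraph) :
  free [:: P5; compl P5; C5] G -> P5_house_C5_free G.
Proof.
move=> Gfree; pose F (a b c d f : G) (i : 'I_5) := tnth [tuple a; b; c; d; f] i.
split=> a b c d f.
- move=> ab bc cd df /negbTE ac /negbTE ad /negbTE af /negbTE bd /negbTE bf /negbTE cf.
  apply: (twinfree_free (H := P5) (f := F a b c d f) Gfree); [by left | by twinfree | ].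
  move=> [[|[|[|[|[|?]]]]] ?] [[|[|[|[|[|?]]]]] ?] //; 
    rewrite /F /tnth /= ?adj_irrefl // ?(ab, bc, cd, df, ac, ad, af, bd, bf, cf) //
    adj_sym ?(ab, bc, cd, df, ac, ad, af, bd, bf, cf) //.
- move=> ab bc cd da fa fb /negbTE ac /negbTE bd /negbTE fc /negbTE fd.
  (* [a c f d b] is a path of the complement. *)
  apply: (twinfree_free (H := compl P5) (f := F a c f d b) Gfree); [by right; left | by twinfree | ].
  move=> [[|[|[|[|[|?]]]]] ?] [[|[|[|[|[|?]]]]] ?] //; 
    rewrite /F /tnth /= ?adj_irrefl // ?(ab, bc, cd, da, fa, fb, ac, bd, fc, fd) //
    adj_sym ?(ab, bc, cd, da, fa, fb, ac, bd, fc, fd) //.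
- move=> ab bc cd df fa /negbTE ac /negbTE ad /negbTE bd /negbTE bf /negbTE cf.
  apply: (twinfree_free (H := C5) (f := F a b c d f) Gfree); [by right; right; left | by twinfree | ].
  move=> [[|[|[|[|[|?]]]]] ?] [[|[|[|[|[|?]]]]] ?] //; 
    rewrite /F /tnth /= ?adj_irrefl // ?(ab, bc, cd, df, fa, ac, ad, bd, bf, cf) //
    adj_sym ?(ab, bc, cd, df, fa, ac, ad, bd, bf, cf) //.
Qed.

Lemma compl_adjE (G : sgraph) (x y : G) :
  adj (x : compl G) y = (x != y) && ~~ adj x y.
Proof. by []. Qed.

Lemma compl_adjN (G : sgraph) (x y : G) :
  x != y -> ~~ adj (x : compl G) y -> adj x y.
Proof. by rewrite compl_adjE => -> /=; rewrite negbK. Qed.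

(** * Disconnected sets without isolated vertices, and their components *)

Section Scattered.

Variable G : sgraph.
Implicit Types (A W X Y : {set G}) (v w x y : G).

Lemma adj_neq x y : adj x y -> x != y.
Proof. by apply: contraTneq => ->; rewrite adj_irrefl. Qed.

Lemma adj_neqN x y z : adj x y -> ~~ adj z y -> x != z.
Proof. by move=> xy; apply: contraNneq => <-. Qed.

Lemma mixedP v A :
  reflect ((exists2 a, a \in A & adj v a) /\ (exists2 a, a \in A & ~~ adj v a))
          (mixed v A).
Proof.
rewrite /mixed /vcomplete /vanticomplete.
apply: (iffP andP) => [[/forall_inPn [a aA va] /forall_inPn [b bA]]|].
  by rewrite negbK => vb; split; [exists b | exists a].
move=> [[a aA va] [b bA vb]]; split; apply/forall_inPn; [by exists b | exists a => //].
by rewrite negbK.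
Qed.

Lemma anticompleteP X Y :
  reflect (forall x y, x \in X -> y \in Y -> ~~ adj x y) (anticomplete X Y).
Proof.
apply: (iffP forall_inP) => [h x y xX yY|h x xX].
  by move/forall_inP: (h x xX); apply.
by apply/forall_inP => y; apply: h.
Qed.

Lemma completeP X Y :
  reflect (forall x y, x \in X -> y \in Y -> adj x y) (complete X Y).
Proof.
apply: (iffP forall_inP) => [h x y xX yY|h x xX].
  by move/forall_inP: (h x xX); apply.
by apply/forall_inP => y; apply: h.
Qed.

(** A non-empty union of connected components of the graph induced by [W]. *)
Definition part W X :=
  [&& X \subset W, X != set0 & anticomplete X (W :\: X)].

(* Minimality makes [A] connected. *)
Definition component W A := minset (part W) A.

Definition scattered W :=
  [forall x in W, exists y in W, adj x y] &&
  [exists X : {set G}, part W X && (W :\: X != set0)].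

Lemma component_sub W A x : component W A -> x \in A -> x \in W.
Proof. by move=> /minsetp /and3P [/subsetP h _ _]; apply: h. Qed.

Lemma component_far W A x y :
  component W A -> x \in A -> y \in W -> y \notin A -> ~~ adj x y.
Proof.
move=> /minsetp /and3P [_ _ /anticompleteP h] xA yW yA.
by apply: h => //; rewrite inE yA.
Qed.

(** Connectedness in usable form: if no edge of [A] left [P], the vertices of [A] satisfying [P]
    would be a part of [W] smaller than [A]. *)
Lemma component_crossing W A (P : pred G) x y :
  component W A -> x \in A -> P x -> y \in A -> ~~ P y ->
  exists a b, [/\ a \in A, b \in A, adj a b, P a & ~~ P b].
Proof.
move=> compA xA Px yA Py; have [/and3P [sA A0 /anticompleteP aA] minA] := minsetP compA.
pose Y := [set a in A | P a].
have [/exists_inP [a aY /exists_inP [b bA /andP [ab Pb]]]|nex] :=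
  boolP [exists a in Y, exists b in A, adj a b && ~~ P b].
  by move: aY; rewrite inE => /andP [aA' Pa]; exists a, b.
suff YA : Y = A by move: yA; rewrite -YA inE (negbTE Py) andbF.
apply: minA; last by apply/subsetP => a; rewrite inE => /andP [].
apply/and3P; split.
- by apply/subsetP => a; rewrite inE => /andP [aA' _]; apply: (subsetP sA).
- by apply/set0Pn; exists x; rewrite inE xA.
apply/anticompleteP => a b aY; have := aY; rewrite !inE => /andP [aA' Pa] /andP [].
case: (boolP (b \in A)) => /= [bA Pb bW|bA _ bW]; last by apply: aA => //; rewrite inE bA.
apply: contra nex => ab; apply/exists_inP; exists a => //.
by apply/exists_inP; exists b => //; rewrite ab Pb.
Qed.

Lemma mixed_crossing W A v :
  component W A -> mixed v A ->
  exists a b, [/\ a \in A, b \in A, adj a b, adj v a & ~~ adj v b].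
Proof.
by move=> compA /mixedP [[x xA vx] [y yA vy]]; apply: (component_crossing compA xA vx yA vy).
Qed.

Lemma component_disjoint W A X x y :
  component W A -> component W X -> x \in X -> x \notin A -> y \in X -> y \notin A.
Proof.
move=> compA compX xX xA yX; apply/negP => yA.
have [a [b [aX bX ab aA bA]]] := component_crossing (P := mem A) compX yX yA xX xA.
by move: (component_far compA aA (component_sub compX bX) bA); rewrite ab.
Qed.

(** A part [A] minimal among those containing [x] is minimal among all parts: a part [Y] inside [A]
    that misses [x] would leave the smaller part [A :\: Y] around [x]. *)
Lemma component_cover W x : x \in W -> exists2 A, component W A & x \in A.
Proof.
move=> xW; pose Q X := part W X && (x \in X).
have /minset_exists [A /minsetP [/andP [pA xA] minA] _] : Q W.
  rewrite /Q xW /part subxx andbT /=; apply/andP; split; first by apply/set0Pn; exists x.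
  by apply/anticompleteP => a b _; rewrite inE => /andP [/negP].
exists A => //; apply/minsetP; split=> // Y /and3P [sY Y0 /anticompleteP aY] YA.
have /and3P [sA _ /anticompleteP aA] := pA.
case: (boolP (x \in Y)) => xY.
  by apply: minA => //; rewrite /Q xY /part sY Y0 andbT /=; apply/anticompleteP.
have {}minA : A :\: Y = A.
  apply: minA; last exact: subsetDl.
  rewrite /Q inE xY xA !andbT; apply/and3P; split.
  - by apply: subset_trans sA; apply: subsetDl.
  - by apply/set0Pn; exists x; rewrite inE xY.
  apply/anticompleteP => a b; rewrite !inE negb_and negbK.
  move=> /andP [aY' aA'] /andP [/orP [bY|bA] bW]; last by apply: aA; rewrite ?inE ?bA.
  by rewrite adj_sym; apply: aY; rewrite ?inE ?aY' ?(subsetP sA).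
by case/set0Pn: Y0 => y yY; move: (subsetP YA y yY); rewrite -{1}minA inE yY.
Qed.

Lemma component_proper W A :
  scattered W -> component W A -> exists2 c, c \in W & c \notin A.
Proof.
move=> /andP [_ /existsP [X /andP [pX WX]]] /minsetP [/and3P [sA _ _] minA].
apply/exists_inP; rewrite -negb_forall_in; apply/negP => /forall_inP WA.
have /and3P [sX _ _] := pX.
have XA : X = A by apply: minA => //; apply: subset_trans sX _; apply/subsetP.
by case/set0Pn: WX => x; rewrite inE XA => /andP [xA /WA]; rewrite (negbTE xA).
Qed.

Lemma component_edge W A x :
  scattered W -> component W A -> x \in A -> exists2 y, y \in A & adj x y.
Proof.
move=> /andP [/forall_inP iW _] compA xA.
have /exists_inP [y yW xy] := iW x (component_sub compA xA).
exists y => //; apply/negPn/negP => yA.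
by move: (component_far compA xA yW yA); rewrite xy.
Qed.

Lemma component_card W A : scattered W -> component W A -> 2 <= #|A|.
Proof.
move=> sW compA; have /and3P [_ /set0Pn [x xA] _] := minsetp compA.
have [y yA xy] := component_edge sW compA xA.
by apply/card_gt1P; exists x, y; rewrite adj_neq.
Qed.

End Scattered.

(** * The vertices outside a maximal scattered set *)

Section MaximalScattered.

Variables (G : sgraph) (W : {set G}).
Hypotheses (P5G : P5_free G) (houseG : house_free G) (C5G : C5_free G).
Hypothesis maxW : maxset (@scattered G) W.
Implicit Types (A : {set G}) (v w x y : G).

Let scatW : scattered W := maxsetp maxW.

(** The set S of the overview; the other vertices outside [W] form Z. *)
Definition attached v := (v \notin W) && [exists u in W, adj v u].

(** Otherwise [v |: W] is still scattered: [A] remains a part of it, and [v] is not isolated. *)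
Lemma attached_touches A v :
  attached v -> component W A -> exists2 a, a \in A & adj v a.
Proof.
move=> /andP [vW /exists_inP [u uW vu]] compA; apply/exists_inP.
rewrite -[X in is_true X]negbK negb_exists_in; apply/negP => /forall_inP far.
suff : v |: W = W by move/setP/(_ v); rewrite !inE eqxx (negbTE vW).
have [_ maxW'] := maxsetP maxW; apply: maxW'; last exact: subsetUr.
have [/forall_inP iW _] := andP scatW.
apply/andP; split.
  apply/forall_inP => x /setU1P [->|xW]; apply/exists_inP.
    by exists u => //; rewrite inE uW orbT.
  have /exists_inP [y yW xy] := iW x xW.
  by exists y => //; rewrite inE yW orbT.
have uA : u \notin A by apply/negP => /far; rewrite vu.
apply/existsP; exists A; apply/andP; split; last first.
  by apply/set0Pn; exists u; rewrite !inE uA uW orbT.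
have /and3P [sA A0 _] := minsetp compA.
apply/and3P; split=> //; first by apply: subset_trans sA (subsetUr _ _).
apply/anticompleteP => a b aA; rewrite !inE => /andP [bA /orP [/eqP ->|bW]].
  by rewrite adj_sym far.
exact: component_far compA aA bW bA.
Qed.

(** An edge with no neighbour in [W] could be added to [W] as a new component. *)
Lemma unattached_nonadj x y :
  x \notin W -> ~~ attached x -> y \notin W -> ~~ attached y -> ~~ adj x y.
Proof.
move=> xW; rewrite {1}/attached xW /= => /exists_inPn xfar.
move=> yW; rewrite {1}/attached yW /= => /exists_inPn yfar.
apply/negP => xy.
suff : [set x; y] :|: W = W by move/setP/(_ x); rewrite !inE eqxx (negbTE xW).
have [_ maxW'] := maxsetP maxW; apply: maxW'; last exact: subsetUr.
have [/forall_inP iW /existsP [X /andP [/and3P [/subsetP sX /set0Pn [z zX] _] _]]] := andP scatW.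
apply/andP; split.
  apply/forall_inP => u; rewrite !inE => /orP [/orP [] /eqP ->|uW]; apply/exists_inP.
  - by exists y => //; rewrite !inE eqxx orbT.
  - by exists x; rewrite ?inE ?eqxx // adj_sym.
  have /exists_inP [v vW uv] := iW u uW.
  by exists v => //; rewrite inE vW orbT.
apply/existsP; exists [set x; y]; apply/andP; split; last first.
  apply/set0Pn; exists z; rewrite !inE sX // orbT andbT negb_or.
  by apply/andP; split; apply/negP => /eqP zE; have := sX _ zX; rewrite zE ?(negbTE xW) ?(negbTE yW).
apply/and3P; split; first exact: subsetUl.
  by apply/set0Pn; exists x; rewrite !inE eqxx.
apply/anticompleteP => a b; rewrite !inE => axy /andP [/negbTE -> /= bW].
by case/orP: axy => /eqP ->; [apply: xfar | apply: yfar].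
Qed.

Lemma mixed_attached A v : component W A -> v \notin W -> mixed v A -> attached v.
Proof.
move=> compA vW /mixedP [[a aA va] _]; rewrite /attached vW /=.
by apply/exists_inP; exists a => //; apply: component_sub aA.
Qed.

(** Otherwise [v] is also mixed on the component of [c]. An edge of each of the two components with
    exactly one end adjacent to [v] then gives an induced path with [v] in the middle. *)
Lemma mixed_complete A v c :
  component W A -> v \notin W -> mixed v A -> c \in W -> c \notin A -> adj v c.
Proof.
move=> compA vW mixv cW cA; apply/negPn/negP => vc.
have [X compX cX] := component_cover cW.
have [x xX vx] := attached_touches (mixed_attached compA vW mixv) compX.
have [c1 [c2 [c1X c2X c12 vc1 vc2]]] := component_crossing compX xX vx cX vc.
have [a [b [aA bA ab va vb]]] := mixed_crossing compA mixv.
have farX z : z \in X -> z \in W /\ z \notin A.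
  move=> zX; split; first exact: component_sub compX zX.
  exact: component_disjoint compA compX cX cA zX.
have [[c1W c1A] [c2W c2A]] := (farX _ c1X, farX _ c2X).
case: (@P5G b a v c1 c2) => //; try by [rewrite adj_sym];
  by rewrite ?(component_far compA).
Qed.

(* Otherwise some [y] of [A] at distance two from the neighbours of [w] would
   end an induced path [c w a x y], where [c] lies in another component. *)
Lemma mixed_dominates A w s :
  component W A -> w \notin W -> mixed w A -> s \in A -> ~~ adj w s ->
  exists u, [/\ u \in A, adj w u & adj s u].
Proof.
move=> compA wW mixw sA ws.
pose P u := adj w u || [exists a in A, adj w a && adj u a].
have [/orP [ws'|/exists_inP [u uA /andP [wu su]]]|Ps] := boolP (P s); first by rewrite ws' in ws.
  by exists u.
have /mixedP [[a0 a0A wa0] _] := mixw.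
have Pa0 : P a0 by rewrite /P wa0.
have [x [y [xA yA xy /orP Px]]] := component_crossing compA a0A Pa0 sA Ps.
rewrite negb_or => /andP [wy /exists_inPn ny].
have {ny} ny a : a \in A -> adj w a -> ~~ adj y a by move=> aA wa; move: (ny a aA); rewrite wa.
have wx : ~~ adj w x by apply/negP => wx; move: (ny x xA wx); rewrite adj_sym xy.
case: Px => [wx'|/exists_inP [a aA /andP [wa xa]]]; first by rewrite wx' in wx.
have [c cW cA] := component_proper scatW compA.
have far b : b \in A -> ~~ adj c b by move=> bA; rewrite adj_sym; apply: component_far cW cA.
case: (@P5G c w a x y) => //; try exact: far.
- by rewrite adj_sym; apply: mixed_complete cW cA.
- by rewrite adj_sym.
- by rewrite adj_sym ny.
Qed.

(** If [w] misses [s], take [u] in [A] adjacent to both [w] and [s], and [c] in another component,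
    adjacent to [v] and [w]. Then [v u w c] is a 4-cycle with roof [s] if [v] sees [u], and
    [c v s u w] is an induced 5-cycle otherwise. *)
Lemma mixed_nonadj_twins A v w s :
  component W A -> v \notin W -> w \notin W -> mixed v A -> mixed w A ->
  ~~ adj v w -> s \in A -> adj v s -> adj w s.
Proof.
move=> compA vW wW mixv mixw vw sA vs; apply/negPn/negP => ws.
have [u [uA wu su]] := mixed_dominates compA wW mixw sA ws.
have [c cW cA] := component_proper scatW compA.
have vc := mixed_complete compA vW mixv cW cA.
have wc := mixed_complete compA wW mixw cW cA.
have far b : b \in A -> ~~ adj c b by move=> bA; rewrite adj_sym; apply: component_far cW cA.
case: (boolP (adj v u)) => vu.
  by case: (@houseG v u w c s) => //; try by [rewrite adj_sym | exact: far | rewrite adj_sym far].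
by case: (@C5G c v s u w) => //; try by [rewrite adj_sym | exact: far | rewrite adj_sym far].
Qed.

(** Being attached and unmixed, [x] is complete to [A] and has a neighbour [c] in another component.
    If [v] missed [x], an edge [a b] of [A] with only [a] adjacent to [v] would give the 4-cycle
    [x a v c] with roof [b]. *)
Lemma mixed_unmixed_adj A v x :
  component W A -> v \notin W -> mixed v A -> attached x -> ~~ mixed x A -> adj v x.
Proof.
move=> compA vW mixv xS unx; apply/negPn/negP => vx.
have [a1 a1A xa1] := attached_touches xS compA.
have xA a : a \in A -> adj x a.
  by move=> aA; apply/negPn/negP => xa; case/negP: unx; apply/mixedP; split; [exists a1 | exists a].
have [a [b [aA bA ab va vb]]] := mixed_crossing compA mixv.
have [c0 cW cA] := component_proper scatW compA.
have [X compX c0X] := component_cover cW.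
have [c cX xc] := attached_touches xS compX.
have {}cA : c \notin A by exact: (component_disjoint compA compX c0X cA cX).
have {}cW := component_sub compX cX.
have vc := mixed_complete compA vW mixv cW cA.
have far d : d \in A -> ~~ adj d c by move=> dA; apply: component_far cW cA.
by case: (@houseG x a v c b) => //; try by [exact: xA | exact: far | rewrite adj_sym // xA].
Qed.

(** If only [v] sees [u], then [w] is mixed on the component of [u]; so is [v], as it would
    otherwise be adjacent to [w]. *)
Lemma attached_nonadj_twins v w u :
  attached v -> attached w -> v != w -> ~~ adj v w -> u \in W -> adj v u -> adj w u.
Proof.
move=> vS wS v'w vw uW vu; apply/negPn/negP => wu.
have [A compA uA] := component_cover uW.
have [b bA wb] := attached_touches wS compA.
have [[vW _] [wW _]] := (andP vS, andP wS).
have mixw : mixed w A by apply/mixedP; split; [exists b | exists u].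
have mixv : mixed v A.
  by apply/negPn/negP => unv; move: vw; rewrite adj_sym (mixed_unmixed_adj compA wW mixw vS unv).
by case/negP: wu; apply: (mixed_nonadj_twins compA vW wW).
Qed.

Lemma divide_or_nonclique A : prime_graph G -> component W A ->
  admits_split_graph_divide G \/
  exists p q, [/\ p \notin W, q \notin W, mixed p A, mixed q A & (p != q) && ~~ adj p q].
Proof.
move=> primeG compA; pose L := [set v | (v \notin W) && mixed v A].
have [cliqueL|] := boolP (clique L); last first.
  case/forall_inPn => p; rewrite inE => /andP [pW mixp] /forall_inPn [q].
  rewrite inE => /andP [qW mixq]; rewrite negb_imply => pq; right.
  by exists p, q.
left; exists A, [set v | attached v && ~~ mixed v A], (W :\: A), L,
  [set v | (v \notin W) && ~~ attached v].
have sA := component_sub compA.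
have attW v : attached v -> v \in W = false by case/andP => /negbTE.
have cA := component_card scatW compA.
have [c cW c'A] := component_proper scatW compA.
(* The component of [c] contains an edge, which gives the two vertices required in [W :\: A]. *)
have [d [dW dA cd]] : exists d, [/\ d \in W, d \notin A & adj c d].
  have [X compX cX] := component_cover cW.
  have [d dX cd] := component_edge scatW compX cX; exists d; split=> //.
    exact: component_sub compX dX.
  exact: component_disjoint compA compX cX c'A dX.
split=> //.
- rewrite /= !andbT -!andbA; do ![apply/andP; split]; apply/pred0P => x /=; rewrite !inE;
    have := (sA x, attW x, @mixed_attached A x compA);
    case: (x \in A); case: (x \in W); case: (attached x); case: (mixed x A) => //= -[[h1 h2] h3];
    by [have := h1 isT | have := h2 isT | have := h3 isT isT].
- apply/setP => x; rewrite !inE; have := @mixed_attached A x compA.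
  case: (x \in A); case: (x \in W); case: (attached x); case: (mixed x A) => //= h;
    by have := h isT isT.
- by apply/card_gt1P; exists c, d; rewrite !inE cW c'A dW dA adj_neq.
(* If nothing outside [W] is mixed on [A], then [A] is a homogeneous set, proper because it misses
   [c]. *)
- apply: contraTneq isT => L0.
  have L_nil v : v \notin W -> ~~ mixed v A.
    by move=> vW; apply/negP => mixv; move/setP/(_ v): L0; rewrite !inE vW mixv.
  case/negP: (primeG A); apply/and3P; split=> //; last first.
    by rewrite -cardsT; apply/proper_card/properP; split; [exact: subsetT | exists c; rewrite ?inE].
  apply/forall_inP => v vA; case: (boolP (v \in W)) => [vW|]; last exact: L_nil.
  apply/mixedP => -[[a aA va] _]; move: (component_far compA aA vW vA).
  by rewrite adj_sym va.
- apply/forall_inP => x; rewrite inE => /andP [xW xS]; apply/forall_inP => y.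
  by rewrite inE => /andP [yW yS]; apply: unattached_nonadj.
- by move=> v; rewrite inE => /andP [].
- apply/completeP => a x aA; rewrite inE => /andP [xS unx].
  have [b bA xb] := attached_touches xS compA.
  rewrite adj_sym; apply/negPn/negP => xa; case/negP: unx; apply/mixedP.
  by split; [exists b | exists a].
- apply/anticompleteP => a x aA; rewrite !inE => /orP [/andP [xA xW]|/andP [xW xS]].
    exact: component_far compA aA xW xA.
  apply: contra xS => ax; rewrite /attached xW; apply/exists_inP; exists a; first exact: sA.
  by rewrite adj_sym.
- apply/completeP => v x; rewrite !inE => /andP [vW mixv] /orP [/andP [xS unx]|/andP [xA xW]].
    exact: mixed_unmixed_adj compA vW mixv xS unx.
  exact: mixed_complete compA vW mixv xW xA.
- apply/anticompleteP => t x; rewrite !inE => /andP [tW tS] /andP [xA xW].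
  by apply: contra tS => tx; rewrite /attached tW; apply/exists_inP; exists x.
Qed.


End MaximalScattered.

(** * Passing to the complement *)

Lemma compl_compl_adj (G : sgraph) (x y : G) :
  adj (x : compl (compl G)) y = adj x y.
Proof.
rewrite !compl_adjE negb_and !negbK; case: (eqVneq x y) => [->|_] /=; last by [].
by rewrite adj_irrefl.
Qed.

(** The vertex [z] tells [x] and [y] apart, which excludes equality as the cause of their
    non-adjacency in the complement. *)
Lemma compl_adjNN (G : sgraph) (x y z : G) :
  adj (x : compl G) z -> ~~ adj (y : compl G) z -> ~~ adj (x : compl G) y -> adj x y.
Proof. by move=> xz yz; apply: compl_adjN; apply: (@adj_neqN (compl G)) xz yz. Qed.

Lemma compl_adj_nonadj (G : sgraph) (x y : G) : adj (x : compl G) y -> ~~ adj x y.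
Proof. by rewrite compl_adjE => /andP []. Qed.

Ltac compl_pattern G sym symN nonadj a b c d f :=
  let sep z := first [ apply: (@compl_adjNN G _ _ z); by auto using sym, symN
                     | rewrite adj_sym; apply: (@compl_adjNN G _ _ z); by auto using sym, symN ] in
  first [ exact: nonadj | rewrite adj_sym; exact: nonadj
        | sep a | sep b | sep c | sep d | sep f ].

(** The house and the 5-vertex path are complementary, and the 5-cycle is self-complementary, its
    complement being the pentagram [a c f b d]. *)
Lemma P5_house_C5_free_compl (G : sgraph) :
  P5_house_C5_free G -> P5_house_C5_free (compl G).
Proof.
move=> [P5G houseG C5G].
have symN (x y : compl G) : ~~ adj x y -> ~~ adj y x by rewrite adj_sym.
have sym (x y : compl G) : adj x y -> adj y x by rewrite adj_sym.
have nonadj (x y : compl G) : adj x y -> ~~ adj (x : G) y by apply: compl_adj_nonadj.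
split=> a b c d f.
- by move=> ab bc cd df ac ad af bd bf cf; case: (@houseG f a d b c); compl_pattern G sym symN nonadj a b c d f.
- by move=> ab bc cd da fa fb ac bd fc fd; case: (@P5G b d f c a); compl_pattern G sym symN nonadj a b c d f.
- by move=> ab bc cd df fa ac ad bd bf cf; case: (@C5G a c f b d); compl_pattern G sym symN nonadj a b c d f.
Qed.

Lemma prime_graph_compl (G : sgraph) : prime_graph G -> prime_graph (compl G).
Proof.
move=> primeG X; apply: contra (primeG X) => /and3P [homX cX pX].
apply/and3P; split=> //; apply/forall_inP => v vX.
have {homX} : ~~ mixed (v : compl G) X by move/forall_inP: homX; apply.
apply: contra => /mixedP [[a aX va] [b bX vb]]; apply/mixedP.
have neq x : x \in X -> v != x by apply: contraTneq => <-.
by split; [exists b | exists a] => //; rewrite compl_adjE neq // va.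
Qed.

(** For [compl (compl G)], whose adjacency agrees with that of [G] only pointwise. *)
Lemma admits_divide_ext (T : finType) (e1 e2 : rel T) s1 i1 s2 i2 :
  e1 =2 e2 -> admits_split_graph_divide (@SGraph T e1 s1 i1) ->
  admits_split_graph_divide (@SGraph T e2 s2 i2).
Proof.
move=> e12 [A [B [C [L [D [h1 h2 h3 h4 h5 h6 h7 h8 h9 h10 h11 h12]]]]]].
have vcE v (X : {set T}) :
    @vcomplete (@SGraph T e2 s2 i2) v X = @vcomplete (@SGraph T e1 s1 i1) v X.
  by apply: eq_forallb_in => x _; rewrite /= e12.
have vaE v (X : {set T}) :
    @vanticomplete (@SGraph T e2 s2 i2) v X = @vanticomplete (@SGraph T e1 s1 i1) v X.
  by apply: eq_forallb_in => x _; rewrite /= e12.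
exists A, B, C, L, D; split=> //.
- apply/forall_inP => x xL; apply/forall_inP => y yL; rewrite /= -e12.
  by move/forall_inP: h6 => /(_ x xL) /forall_inP /(_ y yL).
- apply/forall_inP => x xL; apply/forall_inP => y yL; rewrite /= -e12.
  by move/forall_inP: h7 => /(_ x xL) /forall_inP /(_ y yL).
- by move=> v /h8; rewrite /mixed vcE vaE.
- by apply/forall_inP => x xA; rewrite vcE; move/forall_inP: h9; apply.
- by apply/forall_inP => x xA; rewrite vaE; move/forall_inP: h10; apply.
- by apply/forall_inP => x xA; rewrite vcE; move/forall_inP: h11; apply.
- by apply/forall_inP => x xA; rewrite vaE; move/forall_inP: h12; apply.
Qed.

Lemma admits_divide_compl_compl (G : sgraph) :
  admits_split_graph_divide (compl (compl G)) -> admits_split_graph_divide G.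
Proof.
by case: G => T e s i; apply: admits_divide_ext => x y; apply: (@compl_compl_adj (SGraph s i)).
Qed.

(** * A divide from a scattered set *)

Lemma divide_of_scattered (G : sgraph) (W0 : {set G}) :
  P5_house_C5_free G -> prime_graph G -> scattered W0 ->
  admits_split_graph_divide G \/ admits_split_graph_divide (compl G).
Proof.
move=> freeG primeG sW0; have [W maxW _] := maxset_exists sW0.
have [P5G houseG C5G] := freeG.
have scatW := maxsetp maxW.
have nonclique := divide_or_nonclique P5G houseG maxW primeG.
have [A1 compA1] : exists A, component W A.
  have /andP [_ /existsP [X /andP [/and3P [/subsetP sX /set0Pn [x xX] _] _]]] := scatW.
  by have [A] := component_cover (sX x xX); exists A.
have [c cW cA1] := component_proper scatW compA1.
have [A2 compA2 cA2] := component_cover cW.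
have A12 x : x \in A2 -> x \notin A1.
  by move=> xA2; apply: component_disjoint compA1 compA2 cA2 cA1 xA2.
case: (nonclique A1 compA1) => [|[v1 [w1 [v1W w1W mv1 mw1 /andP [n1 vw1]]]]]; first by left.
case: (nonclique A2 compA2) => [|[v2 [w2 [v2W w2W mv2 mw2 /andP [n2 vw2]]]]]; first by left.
right.
have att A v : component W A -> v \notin W -> mixed v A -> attached W v by apply: mixed_attached.
have unmixed A B v : component W A -> component W B -> (forall x, x \in B -> x \notin A) ->
    v \notin W -> mixed v A -> ~~ mixed v B.
  move=> compA compB disj vW mixv; apply/mixedP => -[_ [b bB]].
  by rewrite (mixed_complete P5G maxW compA vW mixv (component_sub compB bB) (disj b bB)).
pose H := compl G.
(* The non-isolated vertices of the complement of the graph induced by S. *)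
pose U : {set G} := [set x | attached W x && [exists y, [&& attached W y, x != y & ~~ adj x y]]].
have UP x y : attached W x -> attached W y -> x != y -> ~~ adj x y -> x \in U.
  by move=> xS yS xy nxy; rewrite inE xS /=; apply/existsP; exists y; rewrite yS xy.
have LU A v : component W A -> v \notin W -> mixed v A ->
   forall x, attached W x -> ~~ mixed x A -> ~~ adj (v : H) x.
  move=> compA vW mixv x xS unx; rewrite compl_adjE negb_and !negbK.
  by rewrite (mixed_unmixed_adj P5G houseG maxW compA vW mixv xS unx) orbT.
(* The vertices of [U] mixed on [A1] form a part in [H], by [LU]. It contains [v1] but not [v2],
   which is mixed on [A2] and hence not on [A1]. *)
have scatU : scattered (U : {set H}).
  apply/andP; split.
    apply/forall_inP => x; rewrite inE => /andP [xS /existsP [y /and3P [yS xy nxy]]].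
    apply/exists_inP; exists y; last by rewrite compl_adjE xy.
    by apply: (UP y x); rewrite // 1?eq_sym // adj_sym.
  have A21 x : x \in A1 -> x \notin A2 by apply: contraL; apply: A12.
  apply/existsP; exists [set x in U | mixed x A1]; apply/andP; split; last first.
    apply/set0Pn; exists v2; apply/setDP; split.
      by apply: UP vw2 => //; [apply: att mv2 | apply: att mw2].
    apply: contra (unmixed _ _ _ compA2 compA1 A21 v2W mv2).
    by rewrite inE => /andP [].
  apply/and3P; split; first by apply/subsetP => x; rewrite inE => /andP [].
    apply/set0Pn; exists v1; rewrite inE mv1 andbT.
    by apply: UP vw1 => //; [apply: att mv1 | apply: att mw1].
  have Uatt x : x \in U -> attached W x by rewrite inE => /andP [].
  apply/anticompleteP => x y; rewrite inE => /andP [/Uatt/andP [xW _] mx] /setDP [yU].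
  by rewrite inE yU /= => umy; exact: (LU _ _ compA1 xW mx _ (Uatt y yU)).
have [P5H houseH _] := P5_house_C5_free_compl freeG.
have [W' maxW' UW'] : exists2 W' : {set H}, maxset (@scattered H) W' & {subset U <= W'}.
  by have [W' maxW' /subsetP UW'] := maxset_exists scatU; exists W'.
have scatW' := maxsetp maxW'.
(* Vertices of [W] are not [attached], so [b] may lie in Z or in [W]. *)
have FN a b : a \notin W -> ~~ attached W a -> ~~ attached W b -> ~~ adj a b.
  move=> aW aS bS; case: (boolP (b \in W)) => bW; last exact: (unattached_nonadj maxW aW aS bW bS).
  apply: contra aS => ab; rewrite /attached aW; apply/exists_inP; by exists b.
(* If [K] leaves S, some edge [x y] of [H] inside [K] leaves the set of attached vertices mixed on
   [A]. The end [y] is not in S by [LU], nor in [W :\: A], to which [x] is complete in [G]. *)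
have escape A v (K : {set H}) : component W A -> v \notin W -> mixed v A -> component W' K ->
    v \in K -> (forall x, x \in K -> attached W x) \/
    exists y, [/\ y \in K, ~~ attached W y & (y \in W) ==> (y \in A)].
  move=> compA vW mixv compK vK.
  have [/forall_inP|/forall_inPn [z zK zS]] := boolP [forall x in K, attached W x]; first by left.
  right; pose P x := attached W x && mixed (x : G) A.
  have Pv : P v by rewrite /P (att _ _ compA).
  have nPz : ~~ P z by rewrite /P (negbTE zS).
  have [x [y [xK yK xy /andP [xS mx] nPy]]] := component_crossing compK vK Pv zK nPz.
  have /andP [xW _] := xS.
  have yS : ~~ attached W y.
    apply: contraTN xy => yS; apply: (LU A x compA xW mx y yS).
    by move: nPy; rewrite /P yS.
  exists y; split=> //; apply/implyP => yW; apply: contraTT xy => yA.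
  by rewrite compl_adjE (mixed_complete P5G maxW compA xW mx) // andbF.
(* If neither [K1] nor [K2] lies in S, the vertices [y1] and [y2] where they leave S are
   non-adjacent in [G], so both belong to [K1]. Any other component will then do. *)
have [K compK KS] : exists2 K : {set H}, component W' K & forall x, x \in K -> attached W x.
  have v1U : v1 \in U by apply: UP vw1 => //; [apply: att mv1 | apply: att mw1].
  have v2U : v2 \in U by apply: UP vw2 => //; [apply: att mv2 | apply: att mw2].
  have [K1 compK1 v1K] := @component_cover H W' v1 (UW' _ v1U).
  have [K2 compK2 v2K] := @component_cover H W' v2 (UW' _ v2U).
  have [|[y1 [y1K y1S /implyP y1A]]] := escape _ _ _ compA1 v1W mv1 compK1 v1K; first by exists K1.
  have [|[y2 [y2K y2S /implyP y2A]]] := escape _ _ _ compA2 v2W mv2 compK2 v2K; first by exists K2.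
  have y12 : ~~ adj (y1 : G) y2.
    case: (boolP (y1 \in W)) => y1W; last exact: FN.
    case: (boolP (y2 \in W)) => y2W; last by rewrite adj_sym FN.
    exact: component_far compA1 (y1A y1W) y2W (A12 _ (y2A y2W)).
  have y2K1 : y2 \in K1.
    apply/negPn/negP => y2K1.
    have := component_far compK1 y1K (component_sub compK2 y2K) y2K1.
    rewrite compl_adjE y12 andbT negbK => /eqP y12E.
    by move: y2K1; rewrite -y12E y1K.
  have [u uW' uK1] := component_proper scatW' compK1.
  have [K3 compK3 uK3] := component_cover uW'.
  (* Outside S, [x] would be adjacent in [G] to [y1] and [y2]. By [FN] all three are in [W], which
     puts [x] in both [A1] and [A2]. *)
  exists K3 => // x xK3; apply/negPn/negP => xS.
  have xK1 := component_disjoint compK1 compK3 uK3 uK1 xK3.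
  have xfar y : y \in K1 -> adj (y : G) x.
    move=> yK1; apply: compl_adjN; first by apply: contraNneq xK1 => <-.
    exact: component_far compK1 yK1 (component_sub compK3 xK3) xK1.
  have inW y : y \in K1 -> ~~ attached W y -> y \in W.
    by move=> yK1 yS; apply: contraTT (xfar y yK1) => yW; apply: FN.
  have xW : x \in W.
    by apply: contraTT (xfar y1 y1K) => xW; rewrite adj_sym FN.
  have {}y1A := y1A (inW _ y1K y1S); have {}y2A := y2A (inW _ y2K1 y2S).
  case: (boolP (x \in A1)) => xA1.
    by have := component_far compA2 y2A xW; rewrite xfar // => /(_ (contraL (A12 x) xA1)).
  by have := component_far compA1 y1A xW xA1; rewrite xfar.
have [//|[p [q [pW' qW' mp mq /andP [pq]]]]] :=
  divide_or_nonclique P5H houseH maxW' (prime_graph_compl primeG) compK.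
(* In [G], [r] sees [b] but not [a], while the non-adjacent attached vertices [a] and [b] agree on
   [W]; so [r] is not in [W]. If it were attached, missing [a] would put it in [U]. *)
have outside r : r \notin W' -> mixed (r : H) K -> r \notin W /\ ~~ attached W r.
  move=> rW' mixr; have [a [b [aK bK ab ra rb]]] := mixed_crossing compK mixr.
  have {}rb : adj (r : G) b.
    by apply: compl_adjN rb; apply: contraNneq rW' => ->; apply: component_sub bK.
  move: ab ra; rewrite !compl_adjE => /andP [a'b ab] /andP [r'a ra]; split.
    apply: contra ra => rW; rewrite adj_sym.
    apply: (attached_nonadj_twins P5G houseG C5G maxW (KS b bK) (KS a aK)) => //.
    - by rewrite eq_sym.
    - by rewrite adj_sym.
    - by rewrite adj_sym.
  by apply: contra rW' => rS; apply: UW'; apply: UP rS (KS a aK) r'a ra.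
rewrite compl_adjE pq /= negbK => pq_adj.
have [[pW pS] [qW qS]] := (outside p pW' mp, outside q qW' mq).
by move: (FN p q pW pS qS); rewrite pq_adj.
Qed.

(** * Split graphs by forbidden subgraphs, and the conclusion *)

Definition two_K2_free (G : sgraph) := forall x y z t : G,
  adj x y -> adj z t -> ~~ adj x z -> ~~ adj x t -> ~~ adj y z -> ~~ adj y t -> False.

(** Opposite vertices of a 4-cycle are twins, so here distinctness has to be required. *)
Definition C4_free (G : sgraph) := forall x y z t : G,
  adj x y -> adj y z -> adj z t -> adj t x ->
  x != z -> y != t -> ~~ adj x z -> ~~ adj y t -> False.

Lemma scattered_2K2 (G : sgraph) (x y z t : G) :
  adj x y -> adj z t -> ~~ adj x z -> ~~ adj x t -> ~~ adj y z -> ~~ adj y t ->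
  scattered [set x; y; z; t].
Proof.
move=> xy zt xz xt yz yt; apply/andP; split.
  apply/forall_inP => u; rewrite !inE -!orbA => /or4P [] /eqP ->; apply/exists_inP.
  - by exists y; rewrite ?inE ?eqxx ?orbT.
  - by exists x; rewrite ?inE ?eqxx ?orbT // adj_sym.
  - by exists t; rewrite ?inE ?eqxx ?orbT.
  - by exists z; rewrite ?inE ?eqxx ?orbT // adj_sym.
apply/existsP; exists [set x; y]; apply/andP; split; last first.
  apply/set0Pn; exists z; rewrite !inE eqxx orbT andbT negb_or.
  rewrite (adj_neqN zt xt); apply: (adj_neqN zt yt).
apply/and3P; split; first by apply/subsetP => u; rewrite !inE => ->.
  by apply/set0Pn; exists x; rewrite !inE eqxx.
apply/anticompleteP => a b; rewrite !inE => axy /andP [/negbTE -> /=].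
by case/orP: axy => /eqP ->; case/orP => /eqP ->.
Qed.

Lemma cliqueP (G : sgraph) (K : {set G}) :
  reflect (forall x y, x \in K -> y \in K -> x != y -> adj x y) (clique K).
Proof.
apply: (iffP forall_inP) => [h x y xK yK|h x xK].
  by move/forall_inP: (h x xK) => /(_ y yK) /implyP.
by apply/forall_inP => y yK; apply/implyP; apply: h.
Qed.

Lemma clique_setU1 (G : sgraph) (K : {set G}) x :
  clique K -> (forall k, k \in K -> adj x k) -> clique (x |: K).
Proof.
move=> /cliqueP cK xK; apply/cliqueP => a b /setU1P [->|aK] /setU1P [->|bK] //.
- by rewrite eqxx.
- by rewrite xK.
- by rewrite adj_sym xK.
- exact: cK.
Qed.

Lemma clique_setD1 (G : sgraph) (K : {set G}) x : clique K -> clique (K :\ x).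
Proof.
move=> /cliqueP cK; apply/cliqueP => a b /setD1P [_ aK] /setD1P [_ bK]; exact: cK.
Qed.

(* Foeldes and Hammer: the complement of a maximum clique of largest degree sum is stable. *)
Lemma split_of_free (G : sgraph) :
  two_K2_free G -> C4_free G -> C5_free G -> split_graph G.
Proof.
move=> no2K2 noC4 noC5; pose deg (x : G) := #|[set z | adj x z]|.
have clq0 : clique (set0 : {set G}) by apply/cliqueP => x y; rewrite inE.
have [K0 cK0 maxK0] := @arg_maxnP _ set0 (@clique G) (fun K => #|K|) clq0.
pose Q (K : {set G}) := clique K && (#|K| == #|K0|).
have QK0 : Q K0 by rewrite /Q cK0 /=.
have [K /andP [cK /eqP sK] maxK] := @arg_maxnP _ K0 Q (fun K => \sum_(k in K) deg k) QK0.
have {cK0 QK0} max1 (K' : {set G}) : clique K' -> #|K'| <= #|K|.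
  by rewrite sK; apply: maxK0.
exists K, (~: K); split; rewrite ?setUCr // -?setI_eq0 ?setICr //.
have cKP := elimT (cliqueP K) cK.
have nonnbr x : x \notin K -> exists2 k, k \in K & ~~ adj x k.
  move=> xK; apply/exists_inP; rewrite -negb_forall_in; apply/negP => /forall_inP xall.
  by have := max1 _ (clique_setU1 cK xall); rewrite cardsU1 xK ltnn.
have main x y : x \notin K -> y \notin K -> adj x y ->
    (forall k, k \in K -> ~~ adj x k -> ~~ adj y k) -> False.
  move=> xK yK xy nest; have [k kK xk] := nonnbr x xK; have yk := nest k kK xk.
  (* A second non-neighbour [k'] of [x] would, by nesting, make [x y] and [k' k] an induced 2K2. So
     [x] can replace [k] in [K]. *)
  have uniq k' : k' \in K -> k' != k -> adj x k'.
    move=> k'K k'k; apply/negPn/negP => xk'.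
    by apply: (no2K2 x y k' k) => //; [apply: cKP | apply: nest].
  have cKx : clique (x |: (K :\ k)).
    by apply: clique_setU1; [apply: clique_setD1 | move=> l /setD1P [lk lK]; apply: uniq].
  have sD : #|K| = #|K :\ k|.+1 by rewrite (cardsD1 k K) kK.
  (* Otherwise replacing [k] by both [x] and [y] gives a larger clique. *)
  have [k2 k2K [k2k yk2]] : exists2 k2, k2 \in K & k2 != k /\ ~~ adj y k2.
    have [/exists_inP [k2 k2K /andP [? ?]]|] := boolP [exists k2 in K, (k2 != k) && ~~ adj y k2].
      by exists k2.
    rewrite negb_exists_in => /forall_inP ally.
    have /max1 : clique (y |: (x |: (K :\ k))).
      apply: clique_setU1 cKx _ => l /setU1P [->|/setD1P [lk lK]]; first by rewrite adj_sym.
      by have := ally l lK; rewrite lk /= negbK.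
    rewrite !cardsU1 !inE (negbTE xK) (negbTE yK) !andbF orbF sD.
    by rewrite eq_sym adj_neq //= add1n ltnn.
  (* Replacing [k] by [x] keeps the size of the clique, so it cannot raise the degree sum. *)
  have degk : deg x <= deg k.
    have := maxK (x |: (K :\ k)); rewrite /Q cKx cardsU1 !inE (negbTE xK) andbF /= add1n -sD sK eqxx.
    move/(_ isT); rewrite big_setU1 /=; last by rewrite !inE (negbTE xK) andbF.
    by rewrite [in leqRHS](big_setD1 k kK) /= leq_add2r.
  (* Since [y] is a neighbour of [x] only, the neighbourhood of [k] cannot lie inside that of
     [x]. *)
  have [z kz xz] : exists2 z, adj k z & ~~ adj x z.
    apply/exists_inP; rewrite -negb_forall_in; apply/negP => /forall_inP kx.
    move: degk; rewrite leqNgt => /negP; apply; apply/proper_card/properP; split.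
      by apply/subsetP => z; rewrite !inE; apply: kx.
    by exists y; rewrite !inE // adj_sym.
  have k_k2 : adj k k2 by apply: cKP => //; rewrite eq_sym.
  have [yz|yz] := boolP (adj y z); last by apply: (no2K2 x y z k) => //; rewrite adj_sym.
  have [zk2|zk2] := boolP (adj z k2).
    apply: (noC4 x y z k2) => //; first by rewrite adj_sym uniq.
      by apply: contraNneq xk => ->; rewrite adj_sym.
    by apply: contraNneq yk => ->; rewrite adj_sym.
  by apply: (noC5 x y z k k2) => //; rewrite adj_sym // uniq.
apply/forall_inP => x; rewrite inE => xK; apply/forall_inP => y; rewrite inE => yK.
apply/negP => xy.
have [/forall_inP nest|] := boolP [forall k in K, ~~ adj x k ==> ~~ adj y k].
  by apply: (main x y) => // k kK; apply/implyP/nest.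
case/forall_inPn => k kK; rewrite negb_imply negbK => /andP [xk yk].
apply: (main y x) => //; first by rewrite adj_sym.
(* If the non-neighbourhoods in [K] are nested neither way, [x y k l] is an induced 4-cycle. *)
move=> l lK yl; apply/negP => xl.
apply: (noC4 x y k l) => //; rewrite 1?adj_sym //.
- by apply: cKP => //; apply: contraNneq yl => ->.
- by apply: contraNneq xK => ->.
- by apply: contraNneq yK => ->.
Qed.

Theorem mainTheorem4 (G : sgraph) (G_free : free [:: P5; compl P5; C5] G) :
  split_graph G
  \/ (exists X : {set G}, proper_homogeneous X)
  \/ (admits_split_graph_divide G \/ admits_split_graph_divide (compl G)).
Proof.
have freeG := free_P5_house_C5_free G_free.
have [/existsP homG|/existsPn primeG] := boolP [exists X : {set G}, proper_homogeneous X].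
  by right; left.
have [/existsP [W sW]|no2K2] := boolP [exists W : {set G}, scattered W].
  by right; right; apply: divide_of_scattered sW.
have [/existsP [W sW]|noC4] := boolP [exists W : {set compl G}, scattered W].
  right; right; have := divide_of_scattered (P5_house_C5_free_compl freeG) (prime_graph_compl primeG) sW.
  by case=> [|/admits_divide_compl_compl]; [right | left].
left; have [_ _ C5G] := freeG; apply: split_of_free => //.
  move=> x y z t xy zt xz xt yz yt; case/existsP: no2K2.
  by exists [set x; y; z; t]; apply: scattered_2K2.
(* The diagonals [x z] and [y t] of a 4-cycle form an induced 2K2 in the complement. *)
move=> x y z t xy yz zt tx x'z y't xz yt; case/existsP: noC4; exists [set x; z; y; t].
by apply: scattered_2K2; rewrite compl_adjE ?x'z ?y't // negb_and negbK ?(xy, zt) ?orbT //;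
  rewrite adj_sym ?(yz, tx) ?orbT.
Qed.
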